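(* Let $M_1=x_0^{c}x_1^{a_1}\cdots x_n^{a_n}$ and $M_2=x_0^{c}x_1^{b_1}\cdots x_n^{b_n}$ be monomials in $\mathbb{C}[x_0,\ldots,x_n]$ with $1\le c\le a_i$ and $1\le c\le b_i$ for $i=1,\ldots,n$, and let $\mathcal{M}=\{M_1,M_2\}$. Let $M_{12}=\gcd(M_1,M_2)$. Suppose that, for each $i=1,\ldots,n$, either $|a_i-b_i|\in\{0,1\}$ or $|a_i-b_i|\ge c+1$. Then $$\mathrm{rk}_{\mathbb{C}}\,\mathcal{M}=\mathrm{rk}_{\mathbb{C}}\,M_1+\mathrm{rk}_{\mathbb{C}}\,M_2-\mathrm{rk}_{\mathbb{C}}\,M_{12}.$$
   Context: Here $n$ is a nonnegative integer, and a form is a homogeneous polynomial. For a finite collection of forms $\mathcal{F}=\{F_1,\ldots,F_s\}$ in $S=\mathbb{C}[x_0,\ldots,x_n]$ (degrees not necessarily equal), the simultaneous Waring rank $\mathrm{rk}_{\mathbb{C}}\,\mathcal{F}$ is the minimal integer $r$ such that there exist linear forms $L_1,\ldots,L_r\in S$ with the property that every $F_i$ can be written as $F_i=\sum_{j=1}^r\lambda_{i,j}L_j^{d_i}$ with $d_i=\deg F_i$ and $\lambda_{i,j}\in\mathbb{C}$. For a single form, $\mathrm{rk}_{\mathbb{C}}\,F=\mathrm{rk}_{\mathbb{C}}\{F\}$ is the usual complex Waring rank. *)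

(* Defs.v *)
From HB Require Import structures.
From mathcomp Require Import all_boot all_order all_algebra.
From mathcomp Require Import boolp classical_sets.
From mathcomp Require Import mpoly.

Set Implicit Arguments.
Unset Strict Implicit.
Unset Printing Implicit Defensive.

Import Order.TTheory GRing.Theory Num.Theory.
Local Open Scope ring_scope.

(* A collection of forms is a list; its members need not have the same degree.
   The degree of a nonzero form f is (msize f).-1. *)
Definition waring_decomposable (K : fieldType) (m : nat)
    (F : seq {mpoly K[m]}) (r : nat) : Prop :=
  exists L : 'I_r -> {mpoly K[m]},
    (forall j, L j \is 1.-homog) /\
    (forall f, f \in F -> exists lambda : 'I_r -> K,
       f = \sum_(j < r) lambda j *: L j ^+ (msize f).-1).

Definition is_waring_rank (K : fieldType) (m : nat)
    (F : seq {mpoly K[m]}) (r : nat) : Prop :=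
  waring_decomposable F r /\
  (forall s : nat, waring_decomposable F s -> (r <= s)%N).

(* The default value 0 is only reached when no decomposition exists, which
   waring_rankP excludes for forms over a field of characteristic 0. *)
Definition waring_rank (K : fieldType) (m : nat)
    (F : seq {mpoly K[m]}) : nat :=
  xget 0%N [set r | is_waring_rank F r]%classic.

Definition mpoly_dvd (K : fieldType) (m : nat) (p q : {mpoly K[m]}) : Prop :=
  exists u : {mpoly K[m]}, q = u * p.

(* Greatest common divisors are determined up to a nonzero scalar factor. *)
Definition is_mpoly_gcd (K : fieldType) (m : nat)
    (g p q : {mpoly K[m]}) : Prop :=
  [/\ mpoly_dvd g p, mpoly_dvd g q &
      forall h : {mpoly K[m]}, mpoly_dvd h p -> mpoly_dvd h q -> mpoly_dvd h g].

Section Existence.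
Variables (K : numFieldType) (m : nat).
Implicit Types (f L : {mpoly K[m]}) (F : seq {mpoly K[m]}) (d : nat).

Definition power_sum d f : Prop :=
  exists2 s : seq (K * {mpoly K[m]}), all (fun x => x.2 \is 1.-homog) s
    & f = \sum_(x <- s) x.1 *: x.2 ^+ d.

Lemma power_sum0 d : power_sum d 0.
Proof. by exists [::]; rewrite ?big_nil. Qed.

Lemma power_sumD d f g : power_sum d f -> power_sum d g -> power_sum d (f + g).
Proof.
case=> s hs -> [t ht ->]; exists (s ++ t); first by rewrite all_cat hs.
by rewrite big_cat.
Qed.

Lemma power_sumZ d c f : power_sum d f -> power_sum d (c *: f).
Proof.
case=> s hs ->; exists [seq (c * x.1, x.2) | x <- s]; first by rewrite all_map.
by rewrite big_map scaler_sumr; apply: eq_bigr => x _; rewrite scalerA.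
Qed.

Lemma power_sum_sum d (I : Type) (r : seq I) (P : pred I)
    (G : I -> {mpoly K[m]}) :
  (forall i, P i -> power_sum d (G i)) -> power_sum d (\sum_(i <- r | P i) G i).
Proof. by move=> hG; apply: big_ind => //; [exact: power_sum0|exact: power_sumD]. Qed.

Lemma power_sum_exp d L : L \is 1.-homog -> power_sum d (L ^+ d).
Proof.
by move=> hL; exists [:: (1, L)]; rewrite /= ?hL // big_seq1 scale1r.
Qed.

Lemma moment_coefs d : exists c : 'I_d.+2 -> K,
  forall k, (k < d.+2)%N -> \sum_j c j * j%:R ^+ k = (k == 1%N)%:R.
Proof.
pose t : 'rV[K]_d.+2 := \row_j j%:R.
pose V := Vandermonde d.+2 t.
have uV : V \in unitmx.
  rewrite unitmxE unitfE det_Vandermonde; apply/prodf_neq0 => i _.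
  apply/prodf_neq0 => j ij; rewrite !mxE subr_eq0 eqr_nat.
  by rewrite neq_ltn ij orbT.
pose e : 'cV[K]_d.+2 := \col_i ((i : nat) == 1%N)%:R.
exists (fun j => (invmx V *m e) j 0) => k kd.
have := congr1 (fun A : 'cV[K]_d.+2 => A (Ordinal kd) 0) (mulKVmx uV e).
rewrite [RHS]mxE /= => <-; rewrite [RHS]mxE; apply: eq_bigr => j _.
by rewrite !mxE mulrC.
Qed.

Lemma power_sum_mul1 d L M : L \is 1.-homog -> M \is 1.-homog ->
  power_sum d.+1 (L ^+ d * M).
Proof.
move=> hL hM; have [c hc] := moment_coefs d.
suff -> : L ^+ d * M =
    d.+1%:R^-1 *: \sum_(j < d.+2) c j *: (L + j%:R *: M) ^+ d.+1.
  apply/power_sumZ/power_sum_sum => j _; apply/power_sumZ/power_sum_exp.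
  by rewrite rpredD // rpredZ.
have -> : \sum_(j < d.+2) c j *: (L + j%:R *: M) ^+ d.+1 =
    \sum_(k < d.+2) ((k : nat) == 1%N)%:R *: (L ^+ (d.+1 - k) * M ^+ k) *+ 'C(d.+1, k).
  under eq_bigr => j _ do rewrite exprDn scaler_sumr.
  rewrite exchange_big; apply: eq_bigr => k _ /=.
  rewrite -hc // scaler_suml -sumrMnl; apply: eq_bigr => j _.
  by rewrite exprZn -scalerAr !scalerMnr scalerA.
rewrite (bigD1 (Ordinal (isT : (1 < d.+2)%N))) //= big1 ?addr0.
  rewrite subn1 bin1 scale1r expr1 -scaler_nat scalerA mulVf ?scale1r //.
  by rewrite pnatr_eq0.
by move=> k; rewrite -val_eqE /= => /negPf ->; rewrite scale0r mul0rn.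
Qed.

Lemma power_sum_mul d f M : power_sum d f -> M \is 1.-homog ->
  power_sum d.+1 (f * M).
Proof.
case=> s /allP hs -> hM; rewrite mulr_suml big_seq.
apply: power_sum_sum => x /hs hx.
by rewrite -scalerAl; apply/power_sumZ/power_sum_mul1.
Qed.

Lemma power_sum_monomial (e : 'X_{1..m}) : power_sum (mdeg e) 'X_[e].
Proof.
move: {2}(mdeg e) (erefl (mdeg e)) => d; elim: d e => [|d IHd] e he.
  move/eqP: (he); rewrite mdeg_eq0 => /eqP ->.
  exists [:: (1, 0)]; first by rewrite /= rpred0.
  by rewrite mdeg0 big_seq1 expr0 scale1r mpolyX0.
have [i hi] : exists i, e i != 0%N.
  apply/existsP; apply: contraT; rewrite negb_exists => /forallP h0.
  suff e0 : e = 0%MM by rewrite e0 mdeg0 in he.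
  by apply/mnmP => i; rewrite mnm0E; apply/eqP; move: (h0 i); rewrite negbK.
have le1 : (U_(i) <= e)%MM.
  by apply/mnm_lepP => j; rewrite mnm1E; case: eqP => // <-; rewrite lt0n.
rewrite -(submK le1) mpolyXD mdegD mdeg1 addn1.
apply: power_sum_mul; last by rewrite dhomogX /= mdeg1.
apply: IHd; move: he; rewrite -{1}(submK le1) mdegD mdeg1 addn1.
by case.
Qed.

Lemma power_sum_form d f : f \is d.-homog -> power_sum d f.
Proof.
move=> /dhomogP hf; rewrite (mpolyE f) big_seq.
apply: power_sum_sum => e /hf <-.
exact/power_sumZ/power_sum_monomial.
Qed.

Lemma waring_decomposable_exists F :
  (forall f, f \in F -> exists d, f \is d.-homog) ->
  exists r, waring_decomposable F r.
Proof.
elim: F => [|f F IHF] hF; first by exists 0%N, (fun=> 0); split=> [[]|].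
have [|r [L [hL hFL]]] := IHF.
  by move=> g gF; apply: hF; rewrite inE gF orbT.
have [d fd] := hF f (mem_head _ _).
have [s /allP hs fE] := power_sum_form (dhomog_msize fd).
pose N (j : 'I_(size s)) := (nth (0, 0) s j).
pose L' (j : 'I_(size s + r)) :=
  match split j with inl a => (N a).2 | inr b => L b end.
exists (size s + r)%N, L'; split.
  by move=> j; rewrite /L'; case: split => [a|b] //; exact/hs/mem_nth.
move=> g; rewrite inE => /predU1P[->|/hFL [lam {1}->]].
  exists (fun j => match split j with inl a => (N a).1 | inr _ => 0 end).
  rewrite big_split_ord /= [X in _ = _ + X]big1 ?addr0.
    rewrite {1}fE (big_nth (0, 0)) big_mkord; apply: eq_bigr => j _.
    by rewrite /L' (unsplitK (inl j : 'I_(size s) + 'I_r)).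
  by move=> j _; rewrite (unsplitK (inr j : 'I_(size s) + 'I_r)) scale0r.
exists (fun j => match split j with inl _ => 0 | inr b => lam b end).
rewrite big_split_ord /= [X in _ = X + _]big1 ?add0r.
  by apply: eq_bigr => j _; rewrite /L' (unsplitK (inr j : 'I_(size s) + 'I_r)).
by move=> j _; rewrite (unsplitK (inl j : 'I_(size s) + 'I_r)) scale0r.
Qed.

Lemma waring_rankP F :
  (forall f, f \in F -> exists d, f \is d.-homog) ->
  is_waring_rank F (waring_rank F).
Proof.
move=> /waring_decomposable_exists [r hr].
have ex : exists s, `[< waring_decomposable F s >] by exists r; exact/asboolP.
apply: (@xgetPex nat 0%N [set r | is_waring_rank F r]%classic).
case: (ex_minnP ex) => k /asboolP hk kmin; exists k; split=> // s hs.
exact/kmin/asboolP.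
Qed.

End Existence.

(* Main.v *)
Require Import Defs.
From HB Require Import structures.
From mathcomp Require Import all_boot all_order all_algebra.
From mathcomp Require Import separable.
From mathcomp Require Import boolp reals.
From mathcomp Require classical_sets.
From mathcomp Require Import complex mpoly zify ring.

Set Implicit Arguments.
Unset Strict Implicit.
Unset Printing Implicit Defensive.

Import Order.TTheory GRing.Theory Num.Theory.
Local Open Scope ring_scope.

(* The rank of {x_0^c x^a, x_0^c x^b} is the number of exponents e in N^n with
   e <= a or e <= b, so the formula is inclusion-exclusion for two boxes.

   Lower bound: fewer affine points x_0 = 1 would all lie on the zero set of a
   nonzero polynomial supported on those exponents, and multiplying its
   homogenization by x_0 takes care of the points at infinity.

   Upper bound: the set of exponents is turned into a set of points by sending
   e to (1 : z_1(e_1) : ... : z_n(e_n)).  Here z_i(0), ..., z_i(a_i) are the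
   roots of a polynomial whose terms below the leading t^(a_i + 1) have degree
   at most a_i - c, and likewise for b_i; the condition on |a_i - b_i| allows
   such root sets to be nested. *)

(** * Coefficients of powers of linear forms *)

Lemma mcoeffMU (R : nzRingType) (n : nat) (p : {mpoly R[n]}) (i : 'I_n) m :
  (p * 'X_i)@_m = if (0 < m i)%N then p@_(m - U_(i)) else 0.
Proof.
case: ifPn => [mi|/negbTE mi].
  rewrite -{1}(@submK _ U_(i) m) ?lep1mP -?lt0n // addmC; exact: mcoeffMX.
rewrite {1}(mpolyE p) mulr_suml raddf_sum big1 // => k _ /=.
rewrite -scalerAl mcoeffZ -mpolyXD mcoeffX; case: eqP => [km|_]; last first.
  by rewrite mulr0.
by move: mi; rewrite -km mnmDE mnm1E eqxx addn1.
Qed.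

Definition lin_form (R : nzRingType) (n : nat) (l : 'I_n -> R) : {mpoly R[n]} :=
  \sum_i l i *: 'X_i.

Lemma lin_form_homog (R : nzRingType) (n : nat) (l : 'I_n -> R) :
  lin_form l \is 1.-homog.
Proof. by apply: rpred_sum => i _; rewrite rpredZ // dhomogX /= mdeg1. Qed.

Lemma homog1E (R : nzRingType) (n : nat) (L : {mpoly R[n]}) :
  L \is 1.-homog -> L = lin_form (fun i => L@_U_(i)).
Proof.
move=> hL; apply/mpolyP => m; rewrite raddf_sum /=.
have [|m1] := boolP (mdeg m == 1%N); last first.
  rewrite (dhomog_nemf_coeff hL m1) big1 // => i _.
  rewrite mcoeffZ mcoeffX; case: (U_(i)%MM =P m) m1 => [<-|_ _]; last by rewrite mulr0.
  by rewrite mdeg1.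
move=> /mdeg1P[i /eqP ->]; rewrite (bigD1 i) //= mcoeffZ mcoeffXU eqxx mulr1.
rewrite big1 ?addr0 // => j ji.
by rewrite mcoeffZ mcoeffXU (negbTE ji) mulr0.
Qed.

(** [N m] is the multinomial coefficient, built by summing over the last factor. It does not depend
    on [l], and being positive it can be divided out in characteristic zero. *)
Lemma lin_form_power (R : comNzRingType) (n d : nat) :
  exists N : 'X_{1..n} -> nat,
    (forall m, mdeg m = d -> (0 < N m)%N) /\
    (forall (l : 'I_n -> R) m, (lin_form l ^+ d)@_m =
       if mdeg m == d then (N m)%:R * \prod_i l i ^+ m i else 0).
Proof.
elim: d => [|d [N [N_gt0 hN]]].
  exists (fun=> 1%N); split=> // l m.
  rewrite expr0 mcoeff1 mdeg_eq0; case: eqP => // ->.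
  by rewrite mul1r big1 // => i _; rewrite mnm0E.
exists (fun m : 'X_{1..n} => \sum_(i | 0 < m i) N (m - U_(i))%MM)%N; split=> [m md|l m].
  have [i hi] : exists i, m i != 0%N.
    apply/existsP; apply: contraT; rewrite negb_exists => /forallP m0.
    move: md; rewrite mdegE big1 // => i _; apply/eqP.
    by have := m0 i; rewrite negbK.
  rewrite (bigD1 i) ?[(0 < m i)%N]lt0n //= addn_gt0 N_gt0 //.
  have := mdegD U_(i) (m - U_(i)).
  by rewrite addmC submK ?lep1mP // mdeg1 md add1n => -[].
have step i : (lin_form l ^+ d * (l i *: 'X_i))@_m =
    if (0 < m i)%N then
      if mdeg m == d.+1 then (N (m - U_(i))%MM)%:R * \prod_j l j ^+ m j else 0
    else 0.
  rewrite -scalerAr mcoeffZ mcoeffMU; case: ifP => mi; last by rewrite mulr0.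
  have mE : (U_(i) + (m - U_(i)))%MM = m.
    by rewrite addmC submK // lep1mP -lt0n.
  have := mdegD U_(i) (m - U_(i)); rewrite mE mdeg1 add1n => ->.
  rewrite eqSS hN; case: ifP => _; last by rewrite mulr0.
  rewrite mulrCA; congr (_ * _).
  rewrite (bigD1 i) //= [RHS](bigD1 i) //= mulrA -exprS; congr (_ ^+ _ * _).
    by rewrite -[in RHS]mE mnmDE mnm1E eqxx.
  apply: eq_bigr => j ji; congr (_ ^+ _).
  by rewrite mnmBE mnm1E eq_sym (negbTE ji) subn0.
rewrite exprSr {2}/lin_form mulr_sumr raddf_sum /=.
under eq_bigr => i _ do rewrite step.
rewrite -big_mkcond /=; case: ifP => _; last by rewrite big1.
by rewrite natr_sum mulr_suml.
Qed.

(** * Interpolation weights *)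

Section Weights.
Variable K : numFieldType.

(* Interpolation on the nodes z 0, ..., z s, which, owing to the gap below the
   leading term of the node polynomial, also kills the next c powers. *)
Definition extracts (c : nat) (z w : nat -> K) (s : nat) :=
  forall m, (m <= s + c)%N -> \sum_(k < s.+1) w k * z k ^+ m = (m == s)%:R.

(** Powers up to s are handled by inverting the Vandermonde matrix. Beyond s, every node t satisfies
    t^(s+1) = -Q(t), which brings t^m back to powers below s. *)
Lemma extracts_exists c (z : nat -> K) (s : nat) (Q : {poly K}) :
  (c <= s)%N ->
  (forall i j, (i < j <= s)%N -> z i != z j) ->
  \prod_(k < s.+1) ('X - (z k)%:P) = 'X^(s.+1) + Q ->
  (size Q <= (s - c).+1)%N ->
  exists w, extracts c z w s.
Proof.
move=> cs zinj hQ sQ.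
pose t : 'rV[K]_s.+1 := \row_j z j.
pose V := Vandermonde s.+1 t.
have uV : V \in unitmx.
  rewrite unitmxE unitfE det_Vandermonde; apply/prodf_neq0 => i _.
  apply/prodf_neq0 => j ij; rewrite !mxE subr_eq0 eq_sym zinj // ij.
  by rewrite -ltnS ltn_ord.
pose e : 'cV[K]_s.+1 := \col_i ((i : nat) == s)%:R.
pose w (k : nat) := (invmx V *m e) (inord k) 0.
have low m : (m <= s)%N -> \sum_(k < s.+1) w k * z k ^+ m = (m == s)%:R.
  rewrite -ltnS => ms.
  have := congr1 (fun A : 'cV[K]_s.+1 => A (Ordinal ms) 0) (mulKVmx uV e).
  rewrite [RHS]mxE /= => <-; rewrite [RHS]mxE; apply: eq_bigr => j _.
  by rewrite /w inord_val !mxE mulrC.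
exists w => m hm; have [/low //|sm] := leqP m s.
rewrite gtn_eqF //.
have zs (k : 'I_s.+1) : z k ^+ s.+1 = - \sum_(i < (s - c).+1) Q`_i * z k ^+ i.
  have := congr1 (fun p : {poly K} => p.[z k]) hQ.
  rewrite horner_prod (bigD1 k) //= hornerXsubC subrr mul0r.
  rewrite hornerD hornerXn (horner_coef_wide _ sQ) => /esym/eqP.
  by rewrite addr_eq0 => /eqP.
rewrite -(subnK sm).
under eq_bigr => k _.
  rewrite exprD zs mulrN mulrN mulr_sumr mulr_sumr.
  over.
rewrite sumrN exchange_big /= big1 ?oppr0 // => i _.
(* The new exponent is at most (c - 1) + (s - c) = s - 1, so it never hits s. *)
rewrite (eq_bigr (fun k : 'I_s.+1 => Q`_i * (w k * z k ^+ (m - s.+1 + i)))).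
  rewrite -mulr_sumr low; last by have := ltn_ord i; lia.
  by rewrite ltn_eqF ?mulr0 //; have := ltn_ord i; lia.
by move=> k _; rewrite exprD; ring.
Qed.
End Weights.

(** * Nested sets of nodes *)

Section Nodes.
Variable K : numClosedFieldType.

Lemma XnsubC_roots (k : nat) (y : K) : (0 < k)%N -> y != 0 ->
  exists rs : seq K, [/\ uniq rs, size rs = k &
    'X^k - y%:P = \prod_(x <- rs) ('X - x%:P)].
Proof.
move=> k0 y0; have [rs hrs] := closed_field_poly_normal ('X^k - y%:P).
have lc1 : lead_coef ('X^k - y%:P) = 1 := lead_coefXnsubC y k0.
have e : 'X^k - y%:P = \prod_(x <- rs) ('X - x%:P).
  by rewrite {1}hrs lc1 scale1r.
exists rs; split=> //.
  rewrite -separable_prod_XsubC -e unlock derivB derivC subr0 derivXn.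
  apply/Bezout_coprimepP.
  (* X times the derivative is k X^k, and X^k differs from X^k - y by the unit y; this gives the
     Bezout pair. *)
  exists (- y^-1%:P, (y^-1 / k%:R)%:P * 'X).
  suff -> : - y^-1%:P * ('X^k - y%:P) + (y^-1 / k%:R)%:P * 'X * ('X^(k.-1) *+ k)
      = 1 :> {poly K} by rewrite eqpxx.
  rewrite -mulrA mulrnAr -exprS prednK // mulrnAr -mulrnAl -polyCMn.
  rewrite -[(_ / _) *+ _]mulr_natr.
  rewrite divfK ?pnatr_eq0 -?lt0n // mulrBr !mulNr opprK -polyCM mulVf //.
  by ring.
have := congr1 (fun p : {poly K} => size p) e.
by rewrite size_XnsubC // size_prod_XsubC => -[].
Qed.

(** Only the first s + 1 entries of [rs] act as nodes, so one list can serve two values of s, the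
    smaller through a prefix. *)
Lemma seq_extracts c (rs : seq K) (s : nat) (Q : {poly K}) :
  (c <= s)%N -> (s < size rs)%N -> uniq rs ->
  \prod_(x <- take s.+1 rs) ('X - x%:P) = 'X^(s.+1) + Q ->
  (size Q <= (s - c).+1)%N ->
  exists w, extracts c (nth 0 rs) w s.
Proof.
move=> cs ssz urs hQ; apply: extracts_exists cs _ _ => [i j ij|].
  case/andP: ij => ij js; have jsz := leq_ltn_trans js ssz.
  by rewrite nth_uniq ?(ltn_trans ij) // neq_ltn ij.
rewrite -hQ [RHS](big_nth 0) size_takel // big_mkord.
by apply: eq_bigr => i _; rewrite nth_take.
Qed.

(* The nodes are the roots of X^(a+1) - 1, followed by those of 1, X or
   X^(b-a) - 2 according to whether b - a is 0, 1 or larger than c. *)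
Lemma nodes_le c (a b : nat) : (1 <= c)%N -> (c <= a)%N -> (a <= b)%N ->
  (b - a <= 1)%N || (c < b - a)%N ->
  exists z : nat -> K, (exists w, extracts c z w a) /\
    (exists w, extracts c z w b).
Proof.
move=> c1 ca ab gap.
have [rs [urs srs ers]] := @XnsubC_roots a.+1 1 isT (oner_neq0 _).
suff [ss [uss sss disj [Q eQ sQ]]] : exists ss : seq K,
    [/\ uniq ss, size ss = (b - a)%N, ~~ has (mem rs) ss & exists2 Q,
     \prod_(x <- rs ++ ss) ('X - x%:P) = 'X^(b.+1) + Q &
     (size Q <= (b - c).+1)%N].
  have urss : uniq (rs ++ ss) by rewrite cat_uniq urs disj uss.
  exists (nth 0 (rs ++ ss)); split.
    apply: (@seq_extracts c _ a (- 1%:P)) => //.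
    - by rewrite size_cat srs; lia.
    - by rewrite -[in take _ _]srs take_size_cat // -ers.
    - by rewrite size_polyN size_polyC oner_neq0.
  apply: (@seq_extracts c _ b Q) => //.
  - by rewrite (leq_trans ca).
  - by rewrite size_cat srs sss; lia.
  - by rewrite take_oversize // size_cat srs sss; lia.
have [ba|ba] := leqP (b - a) 1.
  exists (nseq (b - a) 0); split.
  - by case: (b - a)%N ba => [|[]].
  - by rewrite size_nseq.
  - rewrite has_nseq; apply/nandP; right; apply/negP => /= rs0.
    have := congr1 (fun p : {poly K} => p.[0]) ers.
    rewrite (big_rem _ rs0) /= hornerM subr0 hornerX mul0r hornerD hornerN.
    by rewrite hornerC hornerXn expr0n add0r => /eqP; rewrite oppr_eq0 oner_eq0.
  (* One Q for both cases: the product is X^(a+1) - 1 if b = a and X^(a+2) - X if b = a + 1. *)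
  exists (- 'X^(b - a)); last by rewrite size_polyN size_polyXn; lia.
  rewrite big_cat /= -ers big_nseq subr0 -Monoid.iteropE /=.
  rewrite -/(GRing.exp _ _) mulrBl mul1r -exprD; congr ('X^_ - _); lia.
have cba : (c < b - a)%N by move: gap; rewrite leqNgt ba.
have two0 : 2%:R != 0 :> K by rewrite pnatr_eq0.
have [||ss [uss sss ess]] := @XnsubC_roots (b - a) 2%:R => //; first lia.
exists ss; split=> //.
  (* A common root x would give 1 = x^((a+1)(b-a)) = 2^(a+1). *)
  apply/hasPn => x xss; apply/negP => /= xrs.
  have x1 : x ^+ a.+1 = 1.
    apply/eqP; rewrite -subr_eq0.
    have := congr1 (fun p : {poly K} => p.[x]) ers.
    by rewrite (big_rem _ xrs) /= hornerM hornerXsubC subrr mul0r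
      hornerD hornerN hornerC hornerXn => ->.
  have x2 : x ^+ (b - a) = 2%:R.
    apply/eqP; rewrite -subr_eq0.
    have := congr1 (fun p : {poly K} => p.[x]) ess.
    by rewrite (big_rem _ xss) /= hornerM hornerXsubC subrr mul0r
      hornerD hornerN hornerC hornerXn => ->.
  have : x ^+ (a.+1 * (b - a)) = x ^+ ((b - a) * a.+1) by rewrite mulnC.
  rewrite exprM x1 expr1n exprM x2 -natrX => /eqP; rewrite eq_sym pnatr_eq1.
  by rewrite -(expn0 2) eqn_exp2l.
(* The lower terms of (X^(a+1) - 1)(X^(b-a) - 2). The degree bound a + 1 <= b - c is exactly the gap
   c < b - a. *)
exists (- 2%:R%:P * 'X^(a.+1) - 'X^(b - a) + 2%:R%:P).
  rewrite big_cat /= -ers -ess.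
  have -> : 'X^(b.+1) = 'X^(a.+1) * 'X^(b - a) :> {poly K}.
    by rewrite -exprD; congr 'X^_; lia.
  ring.
have sX k : (k <= b - c)%N -> (size ('X^k : {poly K}) <= (b - c).+1)%N.
  by rewrite size_polyXn.
apply: leq_trans (size_polyD _ _) _; rewrite geq_max; apply/andP; split.
  apply: leq_trans (size_polyD _ _) _; rewrite size_polyN geq_max sX; last lia.
  rewrite andbT -polyCN mul_polyC (leq_trans (size_scale_leq _ _)) // sX //; lia.
by rewrite size_polyC two0.
Qed.

Lemma nodes c (a b : nat) : (1 <= c)%N -> (c <= a)%N -> (c <= b)%N ->
  (`|a%:Z - b%:Z| = 0 \/ `|a%:Z - b%:Z| = 1) \/ (c.+1)%:Z <= `|a%:Z - b%:Z| ->
  exists z : nat -> K, (exists w, extracts c z w a) /\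
    (exists w, extracts c z w b).
Proof.
move=> c1 ca cb hab; case/orP: (leq_total a b) => le.
  by apply: nodes_le => //; lia.
by have [|z []] := @nodes_le c b a c1 cb le; [lia | exists z].
Qed.
End Nodes.

(** * Exponent vectors and boxes *)

Definition cons_mnm (n c : nat) (a : 'I_n -> nat) : 'X_{1..n.+1} :=
  [multinom if unlift ord0 i is Some j then a j else c | i < n.+1].

Lemma cons_mnm0 (n c : nat) (a : 'I_n -> nat) : cons_mnm c a ord0 = c.
Proof. by rewrite mnmE unlift_none. Qed.

Lemma cons_mnmS (n c : nat) (a : 'I_n -> nat) i :
  cons_mnm c a (lift ord0 i) = a i.
Proof. by rewrite mnmE liftK. Qed.

Lemma mdeg_recl (n : nat) (m : 'X_{1..n.+1}) :
  mdeg m = (m ord0 + \sum_(i < n) m (lift ord0 i))%N.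
Proof. by rewrite mdegE big_ord_recl. Qed.

Lemma mdeg_cons_mnm (n c : nat) (a : 'I_n -> nat) :
  mdeg (cons_mnm c a) = (c + \sum_i a i)%N.
Proof.
rewrite mdeg_recl cons_mnm0; congr (_ + _)%N.
by apply: eq_bigr => i _; rewrite cons_mnmS.
Qed.

Lemma mpolyX_cons (R : nzRingType) (n c : nat) (a : 'I_n -> nat) :
  'X_[cons_mnm c a] =
    'X_ord0 ^+ c * \prod_(i < n) 'X_(lift ord0 i) ^+ a i :> {mpoly R[n.+1]}.
Proof.
rewrite mpolyXE_id big_ord_recl cons_mnm0; congr (_ * _).
by apply: eq_bigr => i _; rewrite cons_mnmS.
Qed.

Lemma mnm_recl (n : nat) (m1 m2 : 'X_{1..n.+1}) :
  m1 ord0 = m2 ord0 -> (forall i, m1 (lift ord0 i) = m2 (lift ord0 i)) ->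
  m1 = m2.
Proof.
by move=> h0 hS; apply/mnmP => i; case: (unliftP ord0 i) => [j|] ->.
Qed.

(** [N] makes the exponent vectors a finite type; in the rank computations it exceeds every a_i, so
    the box is not truncated. *)
Definition box (n N : nat) (a : 'I_n -> nat) : {set {ffun 'I_n -> 'I_N}} :=
  [set e : {ffun 'I_n -> 'I_N} | [forall i, (e i <= a i)%N]].

Lemma boxP (n N : nat) (a : 'I_n -> nat) (e : {ffun 'I_n -> 'I_N}) :
  reflect (forall i, (e i <= a i)%N) (e \in box N a).
Proof. by rewrite inE; apply: forallP. Qed.

(** * Upper bound for the rank *)

Section Bounds.
Variables (K : numFieldType) (n c N : nat).
Implicit Types (F : seq {mpoly K[n.+1]}) (E : {set {ffun 'I_n -> 'I_N}}).
Implicit Types (a : 'I_n -> nat) (m : 'X_{1..n.+1}).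

(* If every exponent is a_i or exceeds a_i + c,
   the total degree leaves no room for the second possibility. *)
Lemma box_extracts (z w : 'I_n -> nat -> K) a m :
  (forall i, a i < N)%N -> (forall i, extracts c (z i) (w i) (a i)) ->
  mdeg m = mdeg (cons_mnm c a) ->
  \sum_(e in box N a) \prod_i (w i (e i) * z i (e i) ^+ m (lift ord0 i)) =
    (m == cons_mnm c a)%:R.
Proof.
move=> aN hw md; rewrite (eq_bigl
  (fun e => e \in family (fun i (k : 'I_N) => k <= a i)%N)).
  rewrite -(bigA_distr_big_dep (fun i (k : 'I_N) => k <= a i)%N
    (fun i (k : 'I_N) => w i k * z i k ^+ m (lift ord0 i))).
  have sumE i : \sum_(k < N | (k <= a i)%N) w i k * z i k ^+ m (lift ord0 i) =
      \sum_(k < (a i).+1) w i k * z i k ^+ m (lift ord0 i).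
    by rewrite (big_ord_widen _ (fun k => w i k * z i k ^+ m (lift ord0 i))
      (aN i)).
  rewrite (eq_bigr _ (fun i _ => sumE i)).
  case: eqP => [->|neq].
    by rewrite big1 // => i _; rewrite cons_mnmS hw ?eqxx ?leq_addr.
  apply/eqP/prodf_eq0/exists_inP; apply: contraPT neq.
  rewrite negb_exists_in => /forall_inP nz; apply.
  have am i : (a i <= m (lift ord0 i))%N.
    rewrite leqNgt; apply/negP => lt; have /negP := nz i isT; apply.
    by rewrite hw ?ltn_eqF // (leq_trans (ltnW lt)) ?leq_addr.
  have ma i : m (lift ord0 i) = a i.
    have /negP := nz i isT; rewrite hw.
      by case: (m _ =P a i) => // _; rewrite eqxx.
    move: md; rewrite mdeg_recl mdeg_cons_mnm (bigD1 i) //= [in RHS](bigD1 i) //=.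
    suff : (\sum_(j < n | j != i) a j <= \sum_(j < n | j != i) m (lift ord0 j))%N.
      have room (x y t A B : nat) :
        (A <= B -> x + (y + B) = c + (t + A) -> y <= t + c)%N by lia.
      exact: room.
    exact: leq_sum.
  apply: mnm_recl => [|i]; last by rewrite ma cons_mnmS.
  apply/eqP; rewrite -(eqn_add2r (\sum_(i < n) m (lift ord0 i))) -mdeg_recl md.
  rewrite mdeg_cons_mnm cons_mnm0; under [in X in _ == X]eq_bigr do rewrite ma.
  exact: eqxx.
by move=> e; apply/boxP/familyP => h i; have := h i.
Qed.

(** All f share the linear forms given by the points (1 : z_1(e_1) : ... : z_n(e_n)). Each f takes
    product weights on its own box, divided by its multinomial coefficient, and zero elsewhere. *)
Lemma waring_decomposable_nodes (z : 'I_n -> nat -> K) E F :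
  (forall f, f \in F -> exists a, [/\ f = 'X_[cons_mnm c a], box N a \subset E,
     (forall i, a i < N)%N & forall i, exists w, extracts c (z i) w (a i)]) ->
  waring_decomposable F #|E|.
Proof.
move=> hF.
pose l (e : {ffun 'I_n -> 'I_N}) (i : 'I_n.+1) : K :=
  if unlift ord0 i is Some k then z k (e k) else 1.
exists (fun j => lin_form (l (enum_val j))); split=> [j|f fF].
  exact: lin_form_homog.
have [a [fE aE aN /choice[w hw]]] := hF f fF.
rewrite fE msizeX -pred_Sn; set d := mdeg _.
have [M [M0 hM]] := @lin_form_power K n.+1 d.
have M0' : (M (cons_mnm c a))%:R != 0 :> K by rewrite pnatr_eq0 -lt0n M0.
pose lam e := (M (cons_mnm c a))%:R^-1 *
  if e \in box N a then \prod_i w i (e i) else 0.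
exists (fun j => lam (enum_val j)).
rewrite -(big_enum_val (fun e => lam e *: lin_form (l e) ^+ d)) /=.
apply/mpolyP => m; rewrite raddf_sum /= mcoeffX.
under eq_bigr => e _ do rewrite mcoeffZ hM.
have [md|md] := eqVneq (mdeg m) d; last first.
  rewrite [RHS]big1; last by move=> e _; rewrite mulr0.
  by case: (_ =P m) md => [<-|]; first by rewrite eqxx.
(* The quotient of multinomial coefficients is 1 at the target monomial; at any other m the sum
   vanishes. *)
transitivity ((M m)%:R / (M (cons_mnm c a))%:R *
    \sum_(e in box N a) \prod_i (w i (e i) * z i (e i) ^+ m (lift ord0 i))).
  rewrite box_extracts // eq_sym; case: eqP => [->|_]; last by rewrite mulr0.
  by rewrite mulr1 divff.
rewrite mulr_sumr big_mkcond [RHS]big_mkcond; apply: eq_bigr => e _.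
rewrite /lam; case: ifP => [eb|_]; last by rewrite mulr0 mul0r if_same.
rewrite (subsetP aE _ eb) big_split big_ord_recl /=.
have -> : \prod_(i < n) l e (lift ord0 i) ^+ m (lift ord0 i) =
    \prod_(i < n) z i (e i) ^+ m (lift ord0 i).
  by apply: eq_bigr => i _; rewrite /l liftK.
rewrite /l unlift_none expr1n mul1r.
by ring.
Qed.

End Bounds.

Lemma cons_mnm_inj (n c1 c2 : nat) (a1 a2 : 'I_n -> nat) :
  cons_mnm c1 a1 = cons_mnm c2 a2 -> c1 = c2 /\ a1 =1 a2.
Proof.
move=> h; split; first by rewrite -(cons_mnm0 c1 a1) h cons_mnm0.
by move=> i; rewrite -(cons_mnmS c1 a1) h cons_mnmS.
Qed.

(** * Lower bound for the rank *)

Section LowerBound.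
Variables (K : numFieldType) (n c N : nat).
Implicit Types (F : seq {mpoly K[n.+1]}) (E : {set {ffun 'I_n -> 'I_N}}).

(* If there were fewer linear forms than exponents in E, some combination of
   the x^e would vanish on all the forms with nonzero x_0-coefficient.  The
   homogenization of that combination, multiplied by x_0^c and by x^(a - e)
   where e is an exponent of top degree in it, then vanishes on all the forms,
   so it pairs to zero with x_0^c x^a although it contains that monomial. *)
Lemma waring_decomposable_ge E F r :
  (0 < c)%N -> waring_decomposable F r ->
  (forall e, e \in E -> exists2 a : 'I_n -> nat,
     'X_[cons_mnm c a] \in F & forall i, (e i <= a i)%N) ->
  (#|E| <= r)%N.
Proof.
move=> c_gt0 [L [hL hF]] hE; rewrite leqNgt; apply/negP => ltrE.
pose l j i := (L j)@_U_(i).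
pose ev (p : 'I_#|E|) : {ffun 'I_n -> 'I_N} := enum_val p.
(* Evaluation of x^e at the affine points. If [l j ord0 = 0], column j is junk from division by
   zero; that case is settled separately by the power of x_0 in [mm q]. *)
pose A : 'M[K]_(#|E|, r) := \matrix_(p, j)
  \prod_(i < n) (l j (lift ord0 i) / l j ord0) ^+ ev p i.
have /rowV0Pn[g /sub_kermxP gA /rV0Pn[p0 gp0]] : kermx A != 0.
  rewrite kermx_eq0 /row_free neq_ltn (leq_ltn_trans (rank_leq_col A)) //.
pose de (p : 'I_#|E|) := (\sum_i ev p i)%N.
case: (@arg_maxnP _ p0 (fun p => g 0 p != 0) de gp0) => p gp pmax.
have [a aF ea] := hE (ev p) (enum_valP p).
have [lam] := hF _ aF; rewrite msizeX -pred_Sn; set d := mdeg _ => hlam.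
have [M [M0 hM]] := @lin_form_power K n.+1 d.
(* The subtraction [de p - de q] truncates, but [pmax] makes it exact whenever g_q is nonzero. *)
pose mm q := cons_mnm (de p - de q + c)
  (fun i => ev q i + (a i - ev p i))%N.
have mmp : mm p = cons_mnm c a.
  apply: mnm_recl => [|i]; first by rewrite !cons_mnm0 subnn.
  by rewrite !cons_mnmS subnKC.
have mmd q : g 0 q != 0 -> mdeg (mm q) = d.
  move=> /pmax qp; rewrite /d !mdeg_cons_mnm big_split /= sumnB //.
  have ple : (de p <= \sum_i a i)%N by apply: leq_sum.
  have cancel (x y t : nat) :
    (y <= x -> x <= t -> x - y + c + (y + (t - x)) = c + t)%N by lia.
  exact: cancel qp ple.
have mmI q : mm q = cons_mnm c a -> q = p.
  rewrite -mmp => /cons_mnm_inj[_ h]; apply/enum_val_inj; apply/ffunP => i.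
  by apply/val_inj/eqP; rewrite /= -(eqn_add2r (a i - ev p i)); apply/eqP/h.
(* Comparison of the coefficients at [mm q] in the decomposition of x_0^c x^a; by [mmI] only q = p
   meets that monomial. *)
have coefE q : g 0 q != 0 ->
    \sum_j lam j * \prod_i l j i ^+ mm q i = (q == p)%:R / (M (mm q))%:R.
  move=> gq; have Mq : (M (mm q))%:R != 0 :> K by rewrite pnatr_eq0 -lt0n M0 ?mmd.
  apply: (mulIf Mq); rewrite divfK //.
  have <- : ('X_[cons_mnm c a] : {mpoly K[n.+1]})@_(mm q) = (q == p)%:R.
    rewrite mcoeffX; congr (nat_of_bool _)%:R.
    by apply/eqP/eqP => [/esym/mmI //|->].
  rewrite hlam raddf_sum mulr_suml; apply: eq_bigr => j _ /=.
  by rewrite mcoeffZ (homog1E (hL j)) hM mmd // eqxx -mulrA (mulrC _%:R).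
have : \sum_q g 0 q * \sum_j lam j * \prod_i l j i ^+ mm q i = 0.
  under eq_bigr => q _ do rewrite mulr_sumr.
  rewrite exchange_big big1 //= => j _.
  under eq_bigr => q _ do rewrite mulrCA.
  rewrite -mulr_sumr; apply/eqP; rewrite mulf_eq0; apply/orP; right; apply/eqP.
  have [l0|l0] := eqVneq (l j ord0) 0.
    rewrite big1 // => q _; rewrite big_ord_recl l0 cons_mnm0 expr0n.
    by rewrite gtn_eqF ?mul0r ?mulr0 // addn_gt0 c_gt0 orbT.
  have := congr1 (fun B : 'rV_r => B 0 j) gA; rewrite !mxE => gAj.
  transitivity (l j ord0 ^+ (de p + c) *
    (\prod_(i < n) l j (lift ord0 i) ^+ (a i - ev p i)) *
    \sum_q g 0 q * A q j); last by rewrite gAj mulr0.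
  rewrite mulr_sumr; apply: eq_bigr => q _; rewrite mxE.
  have [->|gq] := eqVneq (g 0 q) 0; first by rewrite !mul0r mulr0.
  rewrite mulrCA; congr (_ * _); rewrite big_ord_recl cons_mnm0 -mulrA -big_split.
  have -> : (de p + c = de p - de q + c + de q)%N.
    by have := pmax _ gq; rewrite /=; lia.
  rewrite [in RHS]exprD -mulrA; congr (_ * _).
  rewrite /de -prodrXr -big_split; apply: eq_bigr => i _ /=.
  rewrite cons_mnmS exprD expr_div_n [in RHS]mulrCA mulrC; congr (_ * _).
  by rewrite mulrC divfK // expf_neq0.
(* Only q = p survives, leaving g_p divided by a multinomial coefficient, which is nonzero. *)
rewrite (bigD1 p) //= coefE // eqxx big1 ?addr0 => [/eqP|q qp]; last first.
  have [->|gq] := eqVneq (g 0 q) 0; first by rewrite mul0r.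
  by rewrite coefE // (negbTE qp) mul0r mulr0.
rewrite mul1r mulf_eq0 (negbTE gp) invr_eq0 pnatr_eq0 /=.
by apply/negP; rewrite -lt0n M0 // mmd.
Qed.

End LowerBound.

(** * Exact ranks, the gcd and inclusion-exclusion *)

Lemma waring_rank_eq (K : fieldType) (m : nat) (F : seq {mpoly K[m]}) r :
  waring_decomposable F r ->
  (forall s, waring_decomposable F s -> (r <= s)%N) -> waring_rank F = r.
Proof.
move=> Fr rmin; apply: classical_sets.xget_unique => // s [Fs smin].
by apply/eqP; rewrite eqn_leq smin // rmin.
Qed.

Lemma waring_decomposableZ (K : fieldType) (m : nat) (k : K) f r : k != 0 ->
  waring_decomposable [:: f : {mpoly K[m]}] r ->
  waring_decomposable [:: k *: f] r.
Proof.
move=> k0 [L [hL hf]]; exists L; split=> // g; rewrite inE => /eqP ->.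
have [lam e] := hf f (mem_head _ _); exists (fun j => k * lam j).
rewrite msizeZ // {1}e scaler_sumr.
by apply: eq_bigr => j _; rewrite scalerA.
Qed.

(* Leading monomials suffice: writing g = u x^min, the leading monomial of u
   divides x^(m1 - min) and x^(m2 - min), which are coprime. *)
Lemma mpoly_gcd_monomial (K : fieldType) (n : nat) (m1 m2 : 'X_{1..n})
    (g : {mpoly K[n]}) :
  is_mpoly_gcd g 'X_[m1] 'X_[m2] ->
  exists2 k, k != 0 & g = k *: 'X_[[multinom minn (m1 i) (m2 i) | i < n]].
Proof.
set mn := [multinom _ | _ < _] => -[[u1 e1] [u2 e2] univ].
have dvd m : (mn <= m)%MM -> mpoly_dvd 'X_[mn] ('X_[m] : {mpoly K[n]}).
  by move=> le; exists 'X_[m - mn]; rewrite -mpolyXD submK.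
have [||u gE] := univ 'X_[mn].
- by apply: dvd; apply/mnm_lepP => i; rewrite mnmE geq_minl.
- by apply: dvd; apply/mnm_lepP => i; rewrite mnmE geq_minr.
have lead m v : 'X_[m] = v * g ->
    u != 0 /\ m = (mlead v + (mlead u + mn))%MM.
  move=> e; have : v * (u * 'X_[mn]) != 0 :> {mpoly K[n]}.
    by rewrite -gE -e -msize_poly_eq0 msizeX.
  rewrite !mulf_eq0 !negb_or => /and3P[v0 u0 x0]; split=> //.
  by rewrite -(@mleadXm n K m) e gE !mleadM ?mulf_neq0 // mleadXm.
have [u0 l1] := lead _ _ e1; have [_ l2] := lead _ _ e2.
have u00 : mlead u = 0%MM.
  apply/mnmP => i; have := congr1 (fun m : 'X_{1..n} => m i) l1.
  have := congr1 (fun m : 'X_{1..n} => m i) l2.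
  by rewrite !mnmDE mnm0E /mn mnmE; lia.
have := mlead_deg u0; rewrite u00 mdeg0 => /esym/eqP/msize_poly1P[k k0 uk].
by exists k; rewrite // gE uk mul_mpolyC.
Qed.

Section Ranks.
Variables (K : numClosedFieldType) (n c N : nat).
Implicit Types a b : 'I_n -> nat.

Lemma waring_rank_pair a b : (0 < c)%N ->
  (forall i, c <= a i < N)%N -> (forall i, c <= b i < N)%N ->
  (forall i, (`|(a i)%:Z - (b i)%:Z| = 0 \/ `|(a i)%:Z - (b i)%:Z| = 1) \/
     (c.+1)%:Z <= `|(a i)%:Z - (b i)%:Z|) ->
  waring_rank [:: 'X_[cons_mnm c a]; 'X_[cons_mnm c b] : {mpoly K[n.+1]}] =
    #|box N a :|: box N b|.
Proof.
move=> c0 ha hb hab; apply: waring_rank_eq => [|s hs].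
  have /choice[z hz] (i : 'I_n) : exists z : nat -> K,
      (exists w, extracts c z w (a i)) /\ (exists w, extracts c z w (b i)).
    by have /andP[ca _] := ha i; have /andP[cb _] := hb i; apply: nodes.
  apply: (@waring_decomposable_nodes _ _ _ _ z) => f; rewrite !inE.
  case/orP=> /eqP ->; [exists a|exists b]; split=> //.
  - exact: subsetUl.
  - by move=> i; have /andP[] := ha i.
  - by move=> i; have [] := hz i.
  - exact: subsetUr.
  - by move=> i; have /andP[] := hb i.
  - by move=> i; have [] := hz i.
apply: waring_decomposable_ge c0 hs _ => e; rewrite in_setU.
by case/orP=> /boxP he; [exists a|exists b]; rewrite // !inE eqxx ?orbT.
Qed.

(** The scalar [k] accommodates the gcd, fixed only up to a unit. The nodes come from the case b =
    a. *)
Lemma waring_rank_monomial a (k : K) : (0 < c)%N ->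
  (forall i, c <= a i < N)%N -> k != 0 ->
  waring_rank [:: k *: 'X_[cons_mnm c a] : {mpoly K[n.+1]}] = #|box N a|.
Proof.
move=> c0 ha k0; apply: waring_rank_eq => [|s hs].
  apply: waring_decomposableZ => //.
  have /choice[z hz] (i : 'I_n) : exists z : nat -> K,
      (exists w, extracts c z w (a i)) /\ (exists w, extracts c z w (a i)).
    by have /andP[ca _] := ha i; apply: nodes => //; left; left; rewrite subrr.
  apply: (@waring_decomposable_nodes _ _ _ _ z) => f; rewrite !inE.
  move=> /eqP ->; exists a; split=> //.
  - by move=> i; have /andP[] := ha i.
  - by move=> i; have [] := hz i.
have {}hs := waring_decomposableZ (invr_neq0 k0) hs.
rewrite scalerA mulVf // scale1r in hs.
apply: waring_decomposable_ge c0 hs _ => e /boxP he.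
by exists a; rewrite // inE.
Qed.

End Ranks.

Theorem theorem3p2 (R : realType) (n c : nat) (a b : 'I_n -> nat)
    (M1 M2 M12 : {mpoly R[i][n.+1]})
    (hM1 : M1 = 'X_ord0 ^+ c * \prod_(i < n) 'X_(lift ord0 i) ^+ a i)
    (hM2 : M2 = 'X_ord0 ^+ c * \prod_(i < n) 'X_(lift ord0 i) ^+ b i)
    (hc : (1 <= c)%N)
    (hca : forall i : 'I_n, (c <= a i)%N)
    (hcb : forall i : 'I_n, (c <= b i)%N)
    (hM12 : is_mpoly_gcd M12 M1 M2)
    (hab : forall i : 'I_n,
       (`|(a i)%:Z - (b i)%:Z| = 0 \/ `|(a i)%:Z - (b i)%:Z| = 1) \/
       (c.+1)%:Z <= `|(a i)%:Z - (b i)%:Z|) :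
  (waring_rank [:: M1; M2])%:Z =
    (waring_rank [:: M1])%:Z + (waring_rank [:: M2])%:Z
      - (waring_rank [:: M12])%:Z.
Proof.
rewrite -mpolyX_cons in hM1; rewrite -mpolyX_cons in hM2.
rewrite {}hM1 {}hM2 in hM12 *.
have [k k0 ->] := mpoly_gcd_monomial hM12.
pose mn i := minn (a i) (b i).
have -> : [multinom minn (cons_mnm c a i) (cons_mnm c b i) | i < n.+1] =
    cons_mnm c mn.
  by apply: mnm_recl => [|i]; rewrite mnmE ?cons_mnm0 ?minnn ?cons_mnmS.
(* A common strict bound for all a_i and b_i. *)
pose N := (\sum_i (a i + b i)).+1.
have le_sum i : (a i + b i <= \sum_i (a i + b i))%N.
  by rewrite (bigD1 i) //= leq_addr.
have ha i : (c <= a i < N)%N by rewrite hca ltnS (leq_trans _ (le_sum i)) ?leq_addr.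
have hb i : (c <= b i < N)%N by rewrite hcb ltnS (leq_trans _ (le_sum i)) ?leq_addl.
have hmn i : (c <= mn i < N)%N by have := ha i; have := hb i; rewrite /mn; lia.
rewrite (waring_rank_pair _ hc ha hb) //.
have := waring_rank_monomial hc ha (oner_neq0 R[i]).
have := waring_rank_monomial hc hb (oner_neq0 R[i]).
rewrite !scale1r => -> ->; rewrite (waring_rank_monomial hc hmn k0).
(* The gcd corresponds to the intersection of the two boxes. *)
have -> : box N mn = box N a :&: box N b.
  apply/setP => e; rewrite in_setI; apply/boxP/andP.
    by move=> h; split; apply/boxP => i; have := h i; rewrite leq_min => /andP[].
  by move=> [/boxP ea /boxP eb] i; rewrite leq_min ea eb.
by have := cardsUI (box N a) (box N b); lia.
Qed.
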